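(* Let $k, r, \delta$ be integers with $r\ge 2$, $\delta\ge 2$ and $r<k$. Then $$\left\lceil \frac{(k-1)(\delta-1)+1}{(r-1)(\delta-1)+1}\right\rceil -1 \;\le\; \left(\left\lceil \frac{k}{r}\right\rceil-1\right)(\delta-1).$$ Equivalently, for every $n$, the quantity $n-k+1-\mu$ with $\mu=\left\lceil \frac{(k-1)(\delta-1)+1}{(r-1)(\delta-1)+1}\right\rceil -1$ is at least $n-k+1-\left(\left\lceil \frac{k}{r}\right\rceil-1\right)(\delta-1)$.
   Context: The quantity $n-k+1-\mu$ is the paper's upper bound on the minimum distance of $[n,k]$ linear codes with information $(r,\delta)_c$-locality, and $n-k+1-(\lceil k/r\rceil-1)(\delta-1)$ is the upper bound on the minimum distance for codes with the notion of locality $(r,\delta)$ of Prakash et al. The claim itself is only the comparison of these two numbers. *)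

(* Defs.v *)
From mathcomp Require Import all_boot all_order all_algebra.

Set Implicit Arguments.
Unset Strict Implicit.
Unset Printing Implicit Defensive.

Import Order.TTheory GRing.Theory Num.Theory.
Local Open Scope ring_scope.

Definition ceil_div (a b : int) : int := Num.ceil (a%:Q / b%:Q).

Definition mu (k r delta : int) : int :=
  ceil_div ((k - 1) * (delta - 1) + 1) ((r - 1) * (delta - 1) + 1) - 1.

(* Main.v *)
Require Import Defs.
From mathcomp Require Import all_boot all_order all_algebra.
From mathcomp Require Import zify.

Import Order.TTheory GRing.Theory Num.Theory.
Local Open Scope ring_scope.

(** Write d = delta - 1 and c = ceil (k / r), so that k <= c * r. It suffices that
    (k - 1) d + 1 <= ((c - 1) d + 1) ((r - 1) d + 1). Replacing k by c * r, the right
    side minus the left side is (c - 1) (r - 1) d (d - 1), which is nonnegative. *)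

Lemma ceil_div_le (a b m : int) : 0 < b -> (ceil_div a b <= m) = (a <= m * b).
Proof.
move=> b0; rewrite /ceil_div ceil_le_int.
by rewrite ler_pdivrMr ?ltr0z // -intrM ler_int.
Qed.

Theorem mainTheorem5 (k r delta : int)
    (hr : 2 <= r) (hdelta : 2 <= delta) (hrk : r < k) :
  mu k r delta <= (ceil_div k r - 1) * (delta - 1)
  /\ (forall n : int,
        n - k + 1 - (ceil_div k r - 1) * (delta - 1)
          <= n - k + 1 - mu k r delta).
Proof.
suff le_mu : mu k r delta <= (ceil_div k r - 1) * (delta - 1).
  by split=> // n; rewrite lerD2l lerN2.
have r_gt0 : 0 < r by lia.
set c := ceil_div k r.
(* Read backwards at [m = c], the equivalence leaves only [c <= c]. *)
have le_k_cr : k <= c * r by rewrite -ceil_div_le.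
(* Otherwise [c * r <= 0 < k]. *)
have c_ge1 : 0 <= c - 1 by nia.
have d_ge0 : 0 <= delta - 1 by lia.
have den_gt0 : 0 < (r - 1) * (delta - 1) + 1 by nia.
(* The [- 1] in [mu] moves across and becomes the [+ 1] of the factor
   [(c - 1) * (delta - 1) + 1]. *)
rewrite /mu lerBlDr ceil_div_le //.
have slack : 0 <= (c - 1) * (r - 1) * ((delta - 1) * (delta - 2)).
  by rewrite !mulr_ge0 //; lia.
have : k * (delta - 1) <= c * r * (delta - 1) by rewrite ler_wpM2r.
(* Expanded into monomials, right side minus left side is exactly the [slack] term plus
   [(c * r - k) * (delta - 1)], so the goal is linear in the products. *)
lia.
Qed.
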